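(* The following assertion is false: for every integer $n\ge 5$ and every $T\in \mathcal{CT}_n$, $$e^{SO_{red}}(T)\le \begin{cases} \frac{2}{3}(n+1)e^3+\frac{1}{3}(n-5)e^{3\sqrt{2}}, & n\equiv 2 \pmod 3;\\ \frac{1}{3}(2n+1)e^3+\frac{1}{3}(n-13)e^{3\sqrt{2}}+3 e^{\sqrt{13}}, & n\equiv 1 \pmod 3;\\ \frac{1}{3}ne^3+\frac{1}{3}(n-9)e^{3\sqrt{2}}+2 e^{\sqrt{10}}, & n\equiv 0 \pmod 3. \end{cases}$$
   Context: A chemical tree is a (finite) tree $T$ in which every vertex $v$ has degree $d_T(v)\le 4$. $\mathcal{CT}_n$ denotes the set of all chemical trees of order $n$ (i.e. with $n$ vertices). The exponential reduced Sombor index of a graph $G$ with edge set $E(G)$ and vertex degrees $d(v)$ is $$e^{SO_{red}}(G)=\sum_{uv\in E(G)}e^{\sqrt{(d(u)-1)^2+(d(v)-1)^2}}.$$ *)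

(* Defs.v *)
From HB Require Import structures.
From mathcomp Require Import all_boot all_order all_algebra.
From mathcomp Require Import reals sequences exp.

Set Implicit Arguments.
Unset Strict Implicit.
Unset Printing Implicit Defensive.

Import Order.TTheory GRing.Theory Num.Theory.
Local Open Scope ring_scope.

Record sgraph (V : finType) := SGraph {
  adj :> rel V;
  adj_sym : symmetric adj;
  adj_irr : irreflexive adj }.

Definition degree (V : finType) (G : sgraph V) (v : V) : nat :=
  #|[set u | adj G v u]|.

(* An edge uv is the unordered pair {u, v}, so it is counted once. *)
Definition edges (V : finType) (G : sgraph V) : {set {set V}} :=
  [set [set u; v] | u in V, v in V & adj G u v].

Definition graph_connected (V : finType) (G : sgraph V) : Prop :=
  (0 < #|V|)%N /\ forall u v : V, connect (adj G) u v.

(* [ucycle] alone also accepts the empty sequence and the walks u, v, u along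
   an edge; graph cycles are those of length at least 3. *)
Definition acyclic (V : finType) (G : sgraph V) : Prop :=
  forall c : seq V, (3 <= size c)%N -> ~ ucycle (adj G) c.

Definition is_tree (V : finType) (G : sgraph V) : Prop :=
  graph_connected G /\ acyclic G.

Definition chemical_tree (V : finType) (G : sgraph V) : Prop :=
  is_tree G /\ forall v : V, (degree G v <= 4)%N.

(* For an edge e = {u, v}, the inner sum is (d(u) - 1)^2 + (d(v) - 1)^2;
   see [exp_SOred_termE]. *)
Definition exp_SOred (R : realType) (V : finType) (G : sgraph V) : R :=
  \sum_(e in edges G)
    expR (Num.sqrt (\sum_(x in e) ((degree G x)%:R - 1) ^+ 2)).

Lemma exp_SOred_termE (R : realType) (V : finType) (G : sgraph V) (u v : V) :
  adj G u v ->
  expR (Num.sqrt (\sum_(x in [set u; v]) ((degree G x)%:R - 1) ^+ 2)) =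
  expR (Num.sqrt (((degree G u)%:R - 1) ^+ 2 + ((degree G v)%:R - 1) ^+ 2))
  :> R.
Proof.
move=> uv; rewrite big_setU1 ?big_set1 // inE.
by apply: contraTneq uv => ->; rewrite adj_irr.
Qed.

(* Main.v *)
Require Import Defs.
From HB Require Import structures.
From mathcomp Require Import all_boot all_order all_algebra.
From mathcomp Require Import reals sequences exp.
From mathcomp Require Import lra.

(** The third bound already fails at [n = 6].  There its [expR (3 * sqrt 2)]
    term has the negative coefficient [-1], and the bound is
    [2 e^3 - e^(3 sqrt 2) + 2 e^(sqrt 10)].  The spider obtained from the star
    with four rays by subdividing one of them has order 6, maximum degree 4 and
    index [3 e^3 + e^(sqrt 10) + e].  The difference
    [e^3 + e + (e^(3 sqrt 2) - e^(sqrt 10))] is positive because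
    [sqrt 10 <= sqrt 18 = 3 sqrt 2], so no numerical estimate of the exponentials
    is needed.

    The spider is given by a parent function [p] on the ordinals with [p v < v]
    off the root.  Any such function defines a tree ([parent_graph_tree]), whose
    edges are indexed by the vertices other than the root
    ([exp_SOred_parent_graph]). *)

Set Implicit Arguments.
Unset Strict Implicit.
Unset Printing Implicit Defensive.

Import Order.TTheory GRing.Theory Num.Theory.
Local Open Scope ring_scope.

Section ParentGraph.

Variables (n : nat) (p : 'I_n.+1 -> 'I_n.+1).

(** Only the smaller end of an edge can be the parent: this removes a loop at the
    root, which [p] has to send somewhere, and makes the graph acyclic. *)
Definition parent_rel : rel 'I_n.+1 :=
  fun u v => ((u < v)%N && (p v == u)) || ((v < u)%N && (p u == v)).

Lemma parent_rel_sym : symmetric parent_rel.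
Proof. by move=> u v; rewrite /parent_rel orbC. Qed.

Lemma parent_rel_irr : irreflexive parent_rel.
Proof. by move=> u; rewrite /parent_rel ltnn. Qed.

Definition parent_graph : sgraph 'I_n.+1 :=
  SGraph parent_rel_sym parent_rel_irr.

(** The largest vertex of a cycle would have two distinct smaller neighbours,
    whereas its only smaller neighbour is its parent. *)
Lemma parent_graph_acyclic : acyclic parent_graph.
Proof.
case=> // a c c_ge3 cyc_c.
have [m m_c m_max] : exists2 m, m \in a :: c &
    forall v, v \in a :: c -> (v <= m)%N.
  have a_in : a \in a :: c by rewrite mem_head.
  by case: (arg_maxnP (fun v : 'I_n.+1 => v : nat) a_in) => m; exists m.
(* Read from [m], the cycle is [m :: x :: s], and its smaller neighbours [x]
   and [last x s] both equal [p m]. *)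
case: (rot_to m_c) => i s rot_s.
have sz_s : size s = size c by have := congr1 size rot_s; rewrite size_rot => -[].
have max_s v : v \in s -> (v <= m)%N.
  by move=> vs; apply: m_max; rewrite -(mem_rot i) rot_s inE vs orbT.
have := cyc_c; rewrite -(rot_ucycle i) rot_s /ucycle.
have below v : v \in s -> parent_rel m v -> p m = v.
  move=> vs /orP[] /andP[lt_v /eqP //].
  by have := max_s v vs; rewrite leqNgt lt_v.
case: s max_s below sz_s {rot_s} => [|x s] max_s below /= sz_s.
  by move: c_ge3; rewrite /= -sz_s.
rewrite rcons_path => /andP[/and3P[mx _ last_m]] /and3P[_ x_s _].
have eq_x := below x (mem_head x s) mx.
have eq_l : p m = last x s.
  by apply: below; [exact: mem_last | rewrite parent_rel_sym].
case: s sz_s x_s eq_l {max_s below last_m} => [|y s] /= sz_s x_s eq_l.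
  by move: c_ge3; rewrite /= -sz_s.
by move: x_s; rewrite -eq_x eq_l mem_last.
Qed.

Hypothesis p_lt : forall v, v != ord0 -> (p v < v)%N.

Lemma parent_adj v : v != ord0 -> parent_graph (p v) v.
Proof. by move=> v0; rewrite /= /parent_rel p_lt // eqxx. Qed.

Lemma parent_graph_connected : graph_connected parent_graph.
Proof.
split=> [|u v]; first by rewrite card_ord.
have to_root w : connect parent_graph ord0 w.
  have [k] := ubnP w; elim: k w => // k IHk w; rewrite ltnS => w_k.
  have [->|w0] := eqVneq w ord0; first exact: connect0.
  apply: connect_trans (IHk (p w) _) (connect1 (parent_adj w0)).
  exact: leq_trans (p_lt w0) w_k.
apply: connect_trans (to_root v).
rewrite (sym_connect_sym parent_rel_sym); exact: to_root.
Qed.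

Lemma parent_graph_tree : is_tree parent_graph.
Proof. by split; [exact: parent_graph_connected | exact: parent_graph_acyclic]. Qed.

Lemma edges_parent_graph :
  edges parent_graph = [set [set p v; v] | v in [set v | v != ord0]].
Proof.
apply/setP=> e; apply/imset2P/imsetP => [[u v _]|[v]].
  rewrite inE => /orP[] /andP[lt_uv /eqP p_eq] ->.
    by exists v; rewrite ?p_eq // inE -val_eqE /= -lt0n (leq_ltn_trans _ lt_uv).
  exists u; last by rewrite p_eq setUC.
  by rewrite inE -val_eqE /= -lt0n (leq_ltn_trans _ lt_uv).
by rewrite inE => v0 ->; exists (p v) v; rewrite // inE parent_adj.
Qed.

(** The child is the larger end of its edge, so it is determined by the edge. *)
Lemma parent_edge_inj :
  {in [set v | v != ord0] &, injective (fun v => [set p v; v])}.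
Proof.
move=> v w; rewrite !inE => v0 w0 eq_vw.
have : v \in [set p w; w] by rewrite -eq_vw set22.
have : w \in [set p v; v] by rewrite eq_vw set22.
rewrite !inE => /orP[/eqP w_pv|/eqP-> //] /orP[/eqP v_pw|/eqP//].
have := p_lt v0; have := p_lt w0; rewrite -w_pv -v_pw => lt_vw lt_wv.
by have := ltn_trans lt_vw lt_wv; rewrite ltnn.
Qed.

Lemma exp_SOred_parent_graph (R : realType) :
  exp_SOred R parent_graph =
  \sum_(v | v != ord0)
    expR (Num.sqrt (((degree parent_graph (p v))%:R - 1) ^+ 2
                    + ((degree parent_graph v)%:R - 1) ^+ 2)).
Proof.
rewrite /exp_SOred edges_parent_graph (big_imset _ parent_edge_inj) /=.
apply: eq_big => [v|v]; rewrite inE // => v0.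
exact: exp_SOred_termE (parent_adj v0).
Qed.

End ParentGraph.

(** The root 0 has children 1, 2, 3, 4, and 5 is the child of 1. *)
Definition spider_parent (v : 'I_6) : 'I_6 := if v == ord_max then 1 else 0.

Definition spider : sgraph 'I_6 := parent_graph spider_parent.

Lemma spider_parent_lt v : v != ord0 -> (spider_parent v < v)%N.
Proof. by case: v => -[|[|[|[|[|[|]]]]]]. Qed.

Lemma degree_spider v : degree spider v = nth 0%N [:: 4; 2; 1; 1; 1; 1]%N v.
Proof.
rewrite /degree -sum1dep_card big_mkcond !big_ord_recl big_ord0.
by case: v => -[|[|[|[|[|[|]]]]]].
Qed.

Lemma spider_chemical : chemical_tree spider.
Proof.
split; first exact: parent_graph_tree spider_parent_lt.
by move=> v; rewrite degree_spider; case: v => -[|[|[|[|[|[|]]]]]].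
Qed.

Lemma exp_SOred_spider (R : realType) :
  exp_SOred R spider = 3 * expR 3 + expR (Num.sqrt 10) + expR 1.
Proof.
rewrite exp_SOred_parent_graph; last exact: spider_parent_lt.
rewrite big_mkcond !big_ord_recl big_ord0 !degree_spider /=.
have -> : ((4%:R - 1) ^+ 2 + (2%:R - 1) ^+ 2 : R) = 10 by lra.
have -> : ((4%:R - 1) ^+ 2 + (1%:R - 1) ^+ 2 : R) = 3 ^+ 2 by lra.
have -> : ((2%:R - 1) ^+ 2 + (1%:R - 1) ^+ 2 : R) = 1 by lra.
by rewrite sqrtr_sqr ger0_norm // sqrtr1; lra.
Qed.

Theorem mainTheorem2 (R : realType) :
  ~ (forall (n : nat), (5 <= n)%N ->
     forall (V : finType) (T : sgraph V), #|V| = n -> chemical_tree T ->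
       [/\ (n = 2 %[mod 3])%N ->
             exp_SOred R T <=
               2 / 3 * (n%:R + 1) * expR 3
               + 1 / 3 * (n%:R - 5) * expR (3 * Num.sqrt 2),
           (n = 1 %[mod 3])%N ->
             exp_SOred R T <=
               1 / 3 * (2 * n%:R + 1) * expR 3
               + 1 / 3 * (n%:R - 13) * expR (3 * Num.sqrt 2)
               + 3 * expR (Num.sqrt 13)
         & (n = 0 %[mod 3])%N ->
             exp_SOred R T <=
               1 / 3 * n%:R * expR 3
               + 1 / 3 * (n%:R - 9) * expR (3 * Num.sqrt 2)
               + 2 * expR (Num.sqrt 10)]).
Proof.
move=> /(_ 6 isT _ spider (card_ord 6) spider_chemical)[_ _ /(_ erefl)].
rewrite exp_SOred_spider.
have : expR (Num.sqrt 10) <= expR (3 * Num.sqrt 2) :> R.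
  have -> : 3 * Num.sqrt 2 = Num.sqrt (3 ^+ 2 * 2) :> R.
    by rewrite sqrtrM ?exprn_ge0 // sqrtr_sqr ger0_norm.
  by rewrite ler_expR ler_sqrt; lra.
have := expR_gt0 (3 : R); have := expR_gt0 (1 : R).
lra.
Qed.
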